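(* Let $(R,\mathfrak{m},k)$ be a local ring, $M$ a finitely generated $R$-module, $N$ an $\mathfrak{m}$-full submodule of $M$, and $x\in\mathfrak{m}$ with $(\mathfrak{m}N:_Mx)=N$. Then: (1) $(N:_Mx)=(N:_M\mathfrak{m})$. (2) If $p_1,\dots,p_l\in M$ are such that their images form a $k$-basis of $(N:_M\mathfrak{m})/N$, then $xp_1,\dots,xp_l$ form part of a minimal generating set of $N$. (3) If $\{xp_1,\dots,xp_l\}\cup\{z_1,\dots,z_m\}$ is a minimal generating set of $N$ (with $p_i$ as in (2)), then the map $\phi:N\to(N:_M\mathfrak{m})/N$ given by $\phi\big(\sum_i a_ixp_i+\sum_j b_jz_j\big)=\sum_i \overline{a_i}\,\overline{p_i}$ is well defined and $R$-linear. (4) The $R$-linear map $\psi:(N:_M\mathfrak{m})/N\to N/xN$, $\psi(s+N)=xs+xN$, is a split injection. (5) $k$ is a direct summand of $N/xN$.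
   Context: A submodule $N$ of $M$ is $\mathfrak{m}$-full if there exists $x\in\mathfrak{m}$ with $(\mathfrak{m}N:_Mx)=N$.
   Formalization: The local ring R is taken to be Noetherian, and part (5) holds only under the further hypothesis $(N:_M\mathfrak{m})\neq N$, that is, when $(N:_M\mathfrak{m})/N$ is nonzero. Each condition added here is assumed in the paper as well or is needed for the statement above to hold. *)

(* Defs.v *)
From HB Require Import structures.
From mathcomp Require Import all_boot all_order all_algebra.
Set Implicit Arguments. Unset Strict Implicit. Unset Printing Implicit Defensive.
Import GRing.Theory.
Local Open Scope ring_scope.

Section Defs.
Variable R : comUnitRingType.

(* membership in the maximal ideal m = the non-units *)
Definition in_m (r : R) : Prop := r \notin GRing.unit.

(* R is local: the non-units form an ideal (1 != 0 is part of the structure) *)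
Definition local_ring : Prop :=
  forall a b : R, in_m a -> in_m b -> in_m (a + b).

Definition is_ideal (I : R -> Prop) : Prop :=
  I 0 /\ (forall a b, I a -> I b -> I (a + b)) /\ (forall r a, I a -> I (r * a)).

Definition ideal_fg (I : R -> Prop) : Prop :=
  exists s : seq R, forall a, I a <->
    exists c : 'I_(size s) -> R, a = \sum_(i < size s) c i * s`_i.

Definition noetherian : Prop := forall I, is_ideal I -> ideal_fg I.

Variable M : lmodType R.

Definition same_set (A B : M -> Prop) : Prop := forall v, A v <-> B v.

Definition in_span (s : seq M) (v : M) : Prop :=
  exists c : 'I_(size s) -> R, v = \sum_(i < size s) c i *: s`_i.

Definition fin_gen : Prop := exists s : seq M, forall v, in_span s v.

Definition submodule (N : M -> Prop) : Prop :=
  N 0 /\ (forall u v, N u -> N v -> N (u + v)) /\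
  (forall r v, N v -> N (r *: v)).

Definition colon (N : M -> Prop) (x : R) : M -> Prop := fun v => N (x *: v).

Definition colon_m (N : M -> Prop) : M -> Prop :=
  fun v => forall r, in_m r -> N (r *: v).

Definition mmul (N : M -> Prop) : M -> Prop :=
  fun v => exists s : seq M, (forall w, w \in s -> N w) /\
    exists c : 'I_(size s) -> R, (forall i, in_m (c i)) /\
      v = \sum_(i < size s) c i *: s`_i.

Definition smul (x : R) (N : M -> Prop) : M -> Prop :=
  fun v => exists n, N n /\ v = x *: n.

Definition m_full (N : M -> Prop) : Prop :=
  exists x, in_m x /\ same_set (colon (mmul N) x) N.

Definition generates (N : M -> Prop) (s : seq M) : Prop :=
  (forall w, w \in s -> N w) /\ (forall v, N v -> in_span s v).

Definition minimal_gen (N : M -> Prop) (s : seq M) : Prop :=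
  generates N s /\
  (forall i, (i < size s)%N -> ~ generates N (take i s ++ drop i.+1 s)).

(* the images of p_1..p_l in (N :_M m)/N form a k-basis (k = R/m) *)
Definition quot_kbasis (N : M -> Prop) (l : nat) (p : 'I_l -> M) : Prop :=
  (forall i, colon_m N (p i)) /\
  (forall s, colon_m N s -> exists a : 'I_l -> R, N (s - \sum_(i < l) a i *: p i)) /\
  (forall a : 'I_l -> R, N (\sum_(i < l) a i *: p i) -> forall i, in_m (a i)).

End Defs.

(* Main.v *)
(* Since (m N :_M x) = N, x v lies in N iff m v is contained in N: this is (1).
   Let the p_i lift a k-basis of (N :_M m)/N and extend the x p_i to a generating
   family of N by z_j none of which can be dropped; both exist by pruning finite
   generating lists, available as R is Noetherian.  An element of the span of the
   x p_i written as a combination of the z_j has non-unit coefficients (else some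
   z_j could be dropped), hence lies in m N.  So a redundant x p_k would put x (p_k - sum c_i p_i) in m N, i.e.
   p_k - sum c_i p_i in N, against independence: the family is minimal (2).  In a
   minimal generating set every relation has non-unit coefficients, so the
   coefficients a_i of u = sum a_i x p_i + sum b_j z_j are unique modulo m and
   phi u := sum a_i p_i is well defined modulo N (3); it kills x N and inverts
   psi (4).  For (5), N/xN is the direct sum of the line through x p_1, which is
   k, and the classes whose first coordinate lies in m. *)

Require Import Defs.
From HB Require Import structures.
From mathcomp Require Import all_boot all_order all_algebra.
From mathcomp Require Import zify.
From Stdlib Require Import ClassicalEpsilon.
Set Implicit Arguments. Unset Strict Implicit. Unset Printing Implicit Defensive.
Import GRing.Theory.
Local Open Scope ring_scope.

Section MaximalIdeal.
Variable R : comUnitRingType.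

Lemma in_m0 : in_m (0 : R).
Proof. by rewrite /in_m unitr0. Qed.

Lemma in_m1 : ~ in_m (1 : R).
Proof. by rewrite /in_m unitr1. Qed.

Lemma in_mMl (r a : R) : in_m a -> in_m (r * a).
Proof. by rewrite /in_m unitrM negb_and => ->; rewrite orbT. Qed.

Lemma in_mMr (r a : R) : in_m a -> in_m (a * r).
Proof. by rewrite mulrC; apply: in_mMl. Qed.

Hypothesis hloc : local_ring R.

Lemma in_m_subr (a b : R) : in_m (a - b) -> in_m b -> in_m a.
Proof. by move=> hab hb; rewrite -(subrK b a); apply: hloc. Qed.

End MaximalIdeal.

Lemma nth_map_enum (V : nmodType) n (f : 'I_n -> V) (i : 'I_n) :
  (map f (enum 'I_n))`_i = f i.
Proof. by rewrite (nth_map i) ?size_enum_ord // nth_ord_enum. Qed.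

Lemma map_nth_enum (V : nmodType) (s : seq V) :
  map (fun i : 'I_(size s) => s`_i) (enum 'I_(size s)) = s.
Proof.
by rewrite (map_comp (nth 0 s) val) val_enum_ord -/(mkseq _ _) mkseq_nth.
Qed.

Definition rem_nth (T : Type) (s : seq T) (k : nat) := take k s ++ drop k.+1 s.

Lemma mem_rem_nth (T : eqType) (s : seq T) k w : w \in rem_nth s k -> w \in s.
Proof. by rewrite mem_cat => /orP [/mem_take | /mem_drop]. Qed.

Lemma map_rem_nth (T U : Type) (f : T -> U) s k :
  map f (rem_nth s k) = rem_nth (map f s) k.
Proof. by rewrite /rem_nth map_cat map_take map_drop. Qed.

Lemma rem_nth_enum n (i : 'I_n) : rem_nth (enum 'I_n) i = [seq j <- enum 'I_n | j != i].
Proof. by rewrite -rem_filter ?enum_uniq // remE index_enum_ord. Qed.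

Lemma rem_nth_catl (T : Type) (s t : seq T) k :
  (k < size s)%N -> rem_nth (s ++ t) k = rem_nth s k ++ t.
Proof.
move=> lt_ks; rewrite /rem_nth take_cat lt_ks drop_cat.
case: ltnP => [_ | le_sk]; first by rewrite catA.
have -> : k.+1 = size s by apply/eqP; rewrite eqn_leq le_sk lt_ks.
by rewrite subnn drop0 drop_size cats0.
Qed.

Lemma rem_nth_catr (T : Type) (s t : seq T) k :
  rem_nth (s ++ t) (size s + k) = s ++ rem_nth t k.
Proof.
by rewrite /rem_nth; elim: s => [|a s IH] //=; rewrite IH.
Qed.

Lemma size_rem_nth (T : Type) (s : seq T) k :
  (k < size s)%N -> size (rem_nth s k) = (size s).-1.
Proof. by move=> lt_ks; rewrite size_cat size_take lt_ks size_drop; lia. Qed.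

Lemma exists_minimal_rem_nth (T : Type) (Q : seq T -> Prop) s :
  Q s -> exists t, Q t /\ forall k, (k < size t)%N -> ~ Q (rem_nth t k).
Proof.
move: {2}(size s) (leqnn (size s)) => n; elim: n s => [|n IH] s le_sn Qs.
  by exists s; split=> // k; move: le_sn; rewrite leqn0 => /eqP ->.
have [[k [lt_ks Qk]] | irr] := classic (exists k, (k < size s)%N /\ Q (rem_nth s k)).
  by apply: (IH (rem_nth s k)) => //; rewrite size_rem_nth //; lia.
by exists s; split=> // k lt_ks Qk; apply: irr; exists k.
Qed.

Section Submodules.
Variables (R : comUnitRingType) (M : lmodType R).

Section Closure.
Variable P : M -> Prop.
Hypothesis hP : submodule P.

Lemma submod0 : P 0.
Proof. by case: hP. Qed.

Lemma submodD u v : P u -> P v -> P (u + v).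
Proof. by case: hP => _ [hD _]; apply: hD. Qed.

Lemma submodZ r v : P v -> P (r *: v).
Proof. by case: hP => _ [_ hZ]; apply: hZ. Qed.

Lemma submodN v : P v -> P (- v).
Proof. by rewrite -scaleN1r; apply: submodZ. Qed.

Lemma submodB u v : P u -> P v -> P (u - v).
Proof. by move=> Pu Pv; apply: submodD => //; apply: submodN. Qed.

Lemma submod_sum (I : Type) (r : seq I) (Q : pred I) (F : I -> M) :
  (forall i, Q i -> P (F i)) -> P (\sum_(i <- r | Q i) F i).
Proof. exact: (big_ind P submod0 submodD). Qed.

End Closure.

Lemma submodule_colon_m (N : M -> Prop) : submodule N -> submodule (colon_m N).
Proof.
move=> hN; split; first by move=> r _; rewrite scaler0; apply: submod0.
split; first by move=> u v hu hv r hr; rewrite scalerDr; apply: submodD; auto.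
by move=> a v hv r hr; rewrite scalerA mulrC -scalerA; apply: submodZ; auto.
Qed.

Lemma sub_colon_m (N : M -> Prop) v : submodule N -> N v -> colon_m N v.
Proof. by move=> hN Nv r _; apply: submodZ. Qed.

Definition lcomb n (f : 'I_n -> M) (a : 'I_n -> R) : M := \sum_(i < n) a i *: f i.

Lemma lcombD n (f : 'I_n -> M) a b :
  lcomb f (fun i => a i + b i) = lcomb f a + lcomb f b.
Proof. by rewrite /lcomb -big_split; apply: eq_bigr => i _; rewrite scalerDl. Qed.

Lemma lcombB n (f : 'I_n -> M) a b :
  lcomb f (fun i => a i - b i) = lcomb f a - lcomb f b.
Proof. by rewrite /lcomb -sumrB; apply: eq_bigr => i _; rewrite scalerBl. Qed.

Lemma lcombZ n (f : 'I_n -> M) r a : lcomb f (fun i => r * a i) = r *: lcomb f a.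
Proof. by rewrite /lcomb scaler_sumr; apply: eq_bigr => i _; rewrite scalerA. Qed.

Lemma lcombZf n (f : 'I_n -> M) r a : lcomb (fun i => r *: f i) a = r *: lcomb f a.
Proof.
by rewrite /lcomb scaler_sumr; apply: eq_bigr => i _; rewrite !scalerA mulrC.
Qed.

Lemma lcomb0 n (f : 'I_n -> M) : lcomb f (fun=> 0) = 0.
Proof. by rewrite /lcomb big1 // => i _; rewrite scale0r. Qed.

Lemma lcomb_delta n (f : 'I_n -> M) i0 r :
  lcomb f (fun i => if i == i0 then r else 0) = r *: f i0.
Proof.
rewrite /lcomb (bigD1 i0) //= eqxx big1 ?addr0 // => i /negbTE ->.
by rewrite scale0r.
Qed.

Lemma submod_lcomb (P : M -> Prop) n (f : 'I_n -> M) a :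
  submodule P -> (forall i, P (f i)) -> P (lcomb f a).
Proof. by move=> hP Pf; apply: submod_sum => // i _; apply: submodZ. Qed.

Lemma mmul_lcomb (N : M -> Prop) n (f : 'I_n -> M) d :
  (forall i, N (f i)) -> (forall i, in_m (d i)) -> mmul N (lcomb f d).
Proof.
move=> Nf md; exists (map f (enum 'I_n)); split; first by move=> w /mapP [i _ ->].
exists (fun k => (map d (enum 'I_n))`_k); split.
  move=> [k /= ltkn]; have /mapP [i _ ->] // : (map d (enum 'I_n))`_k \in map d (enum 'I_n).
  by apply: mem_nth; rewrite size_map; rewrite size_map in ltkn.
rewrite -(big_mkord xpredT (fun k => (map d (enum 'I_n))`_k *: (map f (enum 'I_n))`_k)).
rewrite size_map size_enum_ord big_mkord.
by apply: eq_bigr => i _; rewrite !nth_map_enum.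
Qed.

Lemma submodule_in_span (s : seq M) : submodule (in_span s).
Proof.
split; first by exists (fun=> 0); rewrite big1 // => i _; rewrite scale0r.
split.
  move=> _ _ [c ->] [d ->]; exists (fun i => c i + d i).
  by rewrite -big_split; apply: eq_bigr => i _; rewrite scalerDl.
move=> r _ [c ->]; exists (fun i => r * c i).
by rewrite scaler_sumr; apply: eq_bigr => i _; rewrite scalerA.
Qed.

Lemma in_span_mem (s : seq M) w : w \in s -> in_span s w.
Proof.
move=> sw; have ltis : (index w s < size s)%N by rewrite index_mem.
exists (fun i => if i == Ordinal ltis then 1 else 0).
rewrite (bigD1 (Ordinal ltis)) //= eqxx scale1r nth_index // big1 ?addr0 //.
by move=> i /negbTE ->; rewrite scale0r.
Qed.

Lemma in_span_min (P : M -> Prop) (s : seq M) v :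
  submodule P -> (forall w, w \in s -> P w) -> in_span s v -> P v.
Proof.
move=> hP sP [c ->]; apply: submod_sum => // i _; apply: submodZ => //.
by apply: sP; apply: mem_nth.
Qed.

Lemma in_span_subset (s t : seq M) v :
  (forall w, w \in s -> in_span t w) -> in_span s v -> in_span t v.
Proof. by move=> st; apply: in_span_min => //; apply: submodule_in_span. Qed.

Lemma in_span_cat (s t : seq M) v : in_span (s ++ t) v ->
  exists v1 v2, [/\ in_span s v1, in_span t v2 & v = v1 + v2].
Proof.
pose P v := exists v1 v2, [/\ in_span s v1, in_span t v2 & v = v1 + v2].
have [s0 [sD sZ]] := submodule_in_span s; have [t0 [tD tZ]] := submodule_in_span t.
apply: (in_span_min (P := P)).
  split; first by exists 0, 0; rewrite addr0.
  split.
    move=> _ _ [u1 [u2 [su1 tu2 ->]]] [v1 [v2 [sv1 tv2 ->]]].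
    by exists (u1 + v1), (u2 + v2); split; [exact: sD | exact: tD | rewrite addrACA].
  move=> r _ [v1 [v2 [sv1 tv2 ->]]].
  by exists (r *: v1), (r *: v2); split; [exact: sZ | exact: tZ | rewrite scalerDr].
move=> w; rewrite mem_cat => /orP [sw | tw].
  by exists w, 0; split; [exact: in_span_mem | by [] | rewrite addr0].
by exists 0, w; split; [by [] | exact: in_span_mem | rewrite add0r].
Qed.

Lemma in_span_catl (s t : seq M) v : in_span s v -> in_span (s ++ t) v.
Proof. by apply: in_span_subset => w sw; apply: in_span_mem; rewrite mem_cat sw. Qed.

Lemma in_span_catr (s t : seq M) v : in_span t v -> in_span (s ++ t) v.
Proof. by apply: in_span_subset => w tw; apply: in_span_mem; rewrite mem_cat tw orbT. Qed.

Lemma in_span1 (a v : M) : in_span [:: a] v -> exists r, v = r *: a.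
Proof. by move=> [c ->]; exists (c ord0); rewrite big_ord1. Qed.

Lemma in_span_enum n (f : 'I_n -> M) v :
  in_span (map f (enum 'I_n)) v <-> exists a, v = lcomb f a.
Proof.
split=> [|[a ->]]; last first.
  apply: submod_lcomb; first exact: submodule_in_span.
  by move=> i; apply: in_span_mem; apply: map_f; rewrite mem_enum.
apply: (in_span_min (P := fun v => exists a, v = lcomb f a)).
  split; first by exists (fun=> 0); rewrite lcomb0.
  split; first by move=> _ _ [a ->] [b ->]; exists (fun i => a i + b i); rewrite lcombD.
  by move=> r _ [a ->]; exists (fun i => r * a i); rewrite lcombZ.
move=> _ /mapP [i _ ->]; exists (fun j => if j == i then 1 else 0).
by rewrite lcomb_delta scale1r.
Qed.

Lemma mem_rem_nth_enum n (f : 'I_n -> M) (i j : 'I_n) :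
  j != i -> f j \in rem_nth (map f (enum 'I_n)) i.
Proof.
by move=> ji; rewrite -map_rem_nth rem_nth_enum map_f // mem_filter ji mem_enum.
Qed.

Lemma in_span_rem_nth_enum n (f : 'I_n -> M) (k : 'I_n) w :
  in_span (rem_nth (map f (enum 'I_n)) k) w -> exists c, c k = 0 /\ w = lcomb f c.
Proof.
rewrite -map_rem_nth rem_nth_enum => span_w.
apply: (in_span_min (P := fun w => exists c, c k = 0 /\ w = lcomb f c) _ _ span_w).
  split; first by exists (fun=> 0); rewrite lcomb0.
  split.
    move=> _ _ [a [ak ->]] [b [bk ->]].
    by exists (fun i => a i + b i); rewrite lcombD ak bk addr0.
  by move=> r _ [a [ak ->]]; exists (fun i => r * a i); rewrite lcombZ ak mulr0.
move=> v /mapP [j]; rewrite mem_filter => /andP [jk _] ->.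
exists (fun i => if i == j then 1 else 0).
by rewrite lcomb_delta scale1r eq_sym (negbTE jk).
Qed.

End Submodules.

Section Generators.
Variables (R : comUnitRingType) (M : lmodType R).

Lemma generates_subset (P : M -> Prop) (s t : seq M) :
  generates P s -> {subset t <= s} -> (forall w, w \in s -> in_span t w) ->
  generates P t.
Proof.
move=> [sP Ps] ts st; split=> [w /ts | v /Ps]; first exact: sP.
exact: in_span_subset.
Qed.

Lemma generates_catC (P : M -> Prop) (s t : seq M) :
  generates P (s ++ t) -> generates P (t ++ s).
Proof.
move=> gen; apply: (generates_subset gen) => [w | w wst].
  by rewrite !mem_cat orbC.
by apply: in_span_mem; rewrite mem_cat orbC -mem_cat.
Qed.

Definition irredundant_ext (P : M -> Prop) (X : seq M) n (f : 'I_n -> M) : Prop :=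
  generates P (X ++ map f (enum 'I_n)) /\
  forall i : 'I_n, ~ generates P (X ++ rem_nth (map f (enum 'I_n)) i).

Lemma exists_irredundant_ext (P : M -> Prop) X s :
  generates P (X ++ s) -> exists n (f : 'I_n -> M), irredundant_ext P X f.
Proof.
move=> gen.
have [t [gent irr]] := exists_minimal_rem_nth (Q := fun t => generates P (X ++ t)) gen.
exists (size t), (fun i => t`_i); rewrite /irredundant_ext map_nth_enum.
by split=> // i; apply: irr.
Qed.

Lemma irredundant_ext_coef_m (P : M -> Prop) X n (f : 'I_n -> M) d :
  irredundant_ext P X f -> in_span X (lcomb f d) -> forall i, in_m (d i).
Proof.
move=> [gen irr] Xd i; apply/negP => unit_di; apply: (irr i).
set Y := X ++ _.
have spanY := submodule_in_span Y.
have fj j : j != i -> in_span Y (f j).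
  by move=> ji; apply: in_span_mem; rewrite mem_cat mem_rem_nth_enum ?orbT.
have fi : in_span Y (f i).
  have -> : f i = (d i)^-1 *: (lcomb f d - \sum_(j | j != i) d j *: f j).
    by rewrite /lcomb (bigD1 i) //= addrK scalerA mulVr ?scale1r.
  apply: submodZ => //; apply: submodB => //; first exact: in_span_catl.
  by apply: submod_sum => // j ji; apply: submodZ => //; apply: fj.
apply: (generates_subset gen).
  by move=> w; rewrite mem_cat => /orP [Xw | /mem_rem_nth fw]; rewrite mem_cat ?Xw ?fw ?orbT.
move=> w; rewrite mem_cat => /orP [Xw | /mapP [j _ ->]].
  by apply: in_span_mem; rewrite mem_cat Xw.
by case: (eqVneq j i) => [-> | ji]; [exact: fi | exact: fj].
Qed.

Lemma minimal_gen_cat (P : M -> Prop) X Y : generates P (X ++ Y) ->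
  (forall k, (k < size X)%N -> ~ generates P (rem_nth X k ++ Y)) ->
  (forall k, (k < size Y)%N -> ~ generates P (X ++ rem_nth Y k)) ->
  minimal_gen P (X ++ Y).
Proof.
move=> gen irrX irrY; split=> // k; rewrite size_cat => lt_k.
change (~ generates P (rem_nth (X ++ Y) k)).
have [lt_kX | le_Xk] := ltnP k (size X); first by rewrite rem_nth_catl //; apply: irrX.
by rewrite -(subnKC le_Xk) rem_nth_catr; apply: irrY; rewrite -(ltn_add2l (size X)) subnKC.
Qed.

Lemma minimal_gen_irredundant_ext (P : M -> Prop) n (f : 'I_n -> M) Y :
  minimal_gen P (map f (enum 'I_n) ++ Y) -> irredundant_ext P Y f.
Proof.
have size_f : size (map f (enum 'I_n)) = n by rewrite size_map size_enum_ord.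
move=> [gen irr]; split=> [|i /generates_catC]; first exact: generates_catC.
rewrite -rem_nth_catl ?size_f //; apply: irr.
by rewrite size_cat size_f ltn_addr.
Qed.

End Generators.

Section Noetherian.
Variables (R : comUnitRingType) (M : lmodType R).

Lemma is_ideal_head_coef (N : M -> Prop) (a : M) t : submodule N ->
  is_ideal (fun c : R => exists v, N v /\ in_span t (v - c *: a)).
Proof.
move=> hN; have ht := submodule_in_span t.
split; first by exists 0; rewrite scale0r subr0; split; [apply: submod0 | apply: submod0].
split.
  move=> c1 c2 [v1 [Nv1 tv1]] [v2 [Nv2 tv2]]; exists (v1 + v2).
  by rewrite scalerDl opprD addrACA; split; apply: submodD.
move=> r c [v [Nv tv]]; exists (r *: v).
by rewrite -scalerA -scalerBr; split; apply: submodZ.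
Qed.

Lemma noetherian_generates : noetherian R -> forall (s : seq M) (N : M -> Prop),
  submodule N -> (forall v, N v -> in_span s v) -> exists g, generates N g.
Proof.
move=> hR; elim=> [|a t IH] N hN Ns.
  exists [::]; split=> [// | v /Ns [c ->]].
  by rewrite big_ord0; apply: submod0 (submodule_in_span _).
have ht := submodule_in_span t.
have [sI hsI] := hR _ (is_ideal_head_coef a t hN).
pose lift_coef (i : 'I_(size sI)) v := N v /\ in_span t (v - sI`_i *: a).
pose f (i : 'I_(size sI)) := epsilon (inhabits 0) (lift_coef i).
have fP (i : 'I_(size sI)) : lift_coef i (f i).
  apply: epsilon_spec; apply/(hsI sI`_i); exists (fun j => if j == i then 1 else 0).
  by rewrite (bigD1 i) //= eqxx mul1r big1 ?addr0 // => j /negbTE ->; rewrite mul0r.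
pose N' v := N v /\ in_span t v.
have hN' : submodule N'.
  split; first by split; apply: submod0.
  split; first by move=> u v [Nu tu] [Nv tv]; split; apply: submodD.
  by move=> r v [Nv tv]; split; apply: submodZ.
have [g' [g'N' g'S]] := IH N' hN' (fun v Nv => Nv.2).
exists (map f (enum 'I_(size sI)) ++ g'); split.
  move=> w; rewrite mem_cat => /orP [/mapP [i _ ->] | /g'N' []] //.
  by case: (fP i).
move=> v Nv; have /(@in_span_cat _ _ [:: a] t) [_ [v2 [/in_span1 [r ->] tv2 ev]]] := Ns v Nv.
have [e er] : exists e, r = \sum_(i < size sI) e i * sI`_i.
  by apply/hsI; exists v; split=> //; rewrite ev addrAC subrr add0r.
have Nu : N (lcomb f e) by apply: submod_lcomb => // i; case: (fP i).
have -> : v = lcomb f e + (v - lcomb f e) by rewrite addrC subrK.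
apply: submodD; first exact: submodule_in_span.
  by apply: in_span_catl; apply/in_span_enum; exists e.
apply: in_span_catr; apply: g'S; split; first exact: submodB.
have -> : v - lcomb f e = v2 - lcomb (fun i => f i - sI`_i *: a) e.
  rewrite ev er scaler_suml /lcomb; under [in RHS]eq_bigr => i _ do rewrite scalerBr scalerA.
  by rewrite sumrB opprB addrA [_ + v2]addrC.
by apply: submodB => //; apply: (submod_lcomb (P := in_span t)) => // i; case: (fP i).
Qed.

Lemma fin_gen_submodule_generates (N : M -> Prop) :
  noetherian R -> fin_gen M -> submodule N -> exists g, generates N g.
Proof. by move=> hR [s Ms] hN; apply: (noetherian_generates hR (s := s)). Qed.

Lemma exists_quot_kbasis (N : M -> Prop) : submodule N ->
  (exists g, generates N g) -> (exists g, generates (colon_m N) g) ->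
  exists l (p : 'I_l -> M), quot_kbasis N p.
Proof.
move=> hN [g [gN Ng]] [G [GC CG]].
have genC : generates (colon_m N) (g ++ G).
  split=> [w | v /CG]; last exact: in_span_catr.
  by rewrite mem_cat => /orP [/gN | /GC] //; apply: sub_colon_m.
have [l [p [gen irr]]] := exists_irredundant_ext genC.
exists l, p; split.
  by move=> i; apply: gen.1; rewrite mem_cat map_f ?orbT ?mem_enum.
split; last by move=> a /Ng; apply: (irredundant_ext_coef_m (conj gen irr)).
move=> s /gen.2 /in_span_cat [v1 [_ [gv1 /in_span_enum [a ->] ->]]].
exists a; rewrite addrK; exact: in_span_min gv1.
Qed.

End Noetherian.

Section MFull.
Variables (R : comUnitRingType) (M : lmodType R) (N : M -> Prop) (x : R).
Hypotheses (hN : submodule N) (hx : in_m x).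
Hypothesis hfull : same_set (colon (mmul N) x) N.

Lemma colon_x_colon_m : same_set (colon N x) (colon_m N).
Proof.
move=> v; split=> [Nxv r mr | Cv]; last exact: Cv.
apply/hfull; have := @mmul_lcomb _ _ N 1 (fun=> x *: v) (fun=> r) (fun=> Nxv) (fun=> mr).
by rewrite /lcomb big_ord1 /colon scalerA mulrC -scalerA.
Qed.

Lemma smul_x_inj s : smul x N (x *: s) -> N s.
Proof.
move=> [n [Nn xsn]]; rewrite -(subrK n s); apply: submodD => //; apply/hfull.
rewrite /colon scalerBr xsn subrr; exists [::]; split=> //.
by exists (fun=> 0); split=> [_ | ]; [exact: in_m0 | rewrite big_ord0].
Qed.

Section Basis.
Variables (l : nat) (p : 'I_l -> M).
Hypothesis hp : quot_kbasis N p.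

Local Notation X := (map (fun i => x *: p i) (enum 'I_l)).

Lemma quot_kbasis_xN i : N (x *: p i).
Proof. exact: hp.1. Qed.

Lemma lcomb_quot_kbasis_N c : (forall i, in_m (c i)) -> N (lcomb p c).
Proof. by move=> mc; apply: submod_sum => // i _; apply: hp.1. Qed.

Lemma quot_kbasis_irredundant m (z : 'I_m -> M) : irredundant_ext N X z ->
  forall k : 'I_l, ~ generates N (rem_nth X k ++ map z (enum 'I_m)).
Proof.
move=> hz k [_ genN].
have /in_span_cat [w1 [w2 [/in_span_rem_nth_enum [c [ck ->]] zw2 xpk]]] :=
  genN _ (quot_kbasis_xN k).
have w2E : w2 = x *: (p k - lcomb p c).
  by rewrite scalerBr -lcombZf xpk addrAC subrr add0r.
have : N (p k - lcomb p c).
  apply/hfull; rewrite /colon -w2E.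
  have [d w2d] := iffLR (in_span_enum _ _) zw2; rewrite w2d; apply: mmul_lcomb.
    by move=> j; apply: hz.1.1; rewrite mem_cat map_f ?orbT ?mem_enum.
  apply: (irredundant_ext_coef_m hz); rewrite -w2d w2E scalerBr -lcombZf.
  apply: submodB; first exact: submodule_in_span.
    apply: in_span_mem; exact: (map_f (fun i => x *: p i) (mem_enum _ k)).
  by apply/in_span_enum; exists c.
rewrite -[p k]scale1r -(lcomb_delta p k) -lcombB => /hp.2.2 /(_ k).
by rewrite eqxx ck subr0; apply: in_m1.
Qed.

Lemma exists_minimal_gen_ext : (exists g, generates N g) ->
  exists m (z : 'I_m -> M), minimal_gen N (X ++ map z (enum 'I_m)).
Proof.
move=> [g [gN Ng]].
have genX : generates N (X ++ g).
  split=> [w | v /Ng]; last exact: in_span_catr.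
  by rewrite mem_cat => /orP [/mapP [i _ ->] | /gN] //; apply: quot_kbasis_xN.
have [m [z hz]] := exists_irredundant_ext genX.
exists m, z; apply: minimal_gen_cat; first exact: hz.1.
  move=> k; rewrite size_map size_enum_ord => lt_kl.
  exact: (quot_kbasis_irredundant (k := Ordinal lt_kl) hz).
by move=> k; rewrite size_map size_enum_ord => lt_km; exact: (hz.2 (Ordinal lt_km)).
Qed.

Section Coordinates.
Variables (m : nat) (z : 'I_m -> M).
Hypothesis hmin : minimal_gen N (X ++ map z (enum 'I_m)).

Local Notation comb a b := (lcomb (fun i => x *: p i) a + lcomb z b).

Lemma comb_coef_m a b a' b' : comb a b = comb a' b' -> forall i, in_m (a i - a' i).
Proof.
move=> e; apply: (irredundant_ext_coef_m (minimal_gen_irredundant_ext hmin)).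
apply/in_span_enum; exists (fun j => b' j - b j).
by rewrite !lcombB; apply/eqP; rewrite subr_eq eq_sym addrAC subr_eq e addrC.
Qed.

Lemma comb_N a b : N (comb a b).
Proof.
have Ngen w : w \in X ++ map z (enum 'I_m) -> N w := hmin.1.1 w.
apply: (submodD hN); apply: (submod_lcomb _ hN) => i; apply: Ngen.
  by rewrite mem_cat (map_f (fun i => x *: p i)) ?mem_enum.
by rewrite mem_cat map_f ?orbT ?mem_enum.
Qed.

Lemma N_comb u : N u -> exists a b, u = comb a b.
Proof.
move=> /hmin.1.2 /in_span_cat [_ [_ [/in_span_enum [a ->] /in_span_enum [b ->] ->]]].
by exists a, b.
Qed.

(* Arbitrary when [~ N u]; unique modulo m by [comb_coef_m]. *)
Definition coord (u : M) : 'I_l -> R :=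
  epsilon (inhabits (fun=> 0)) (fun a => exists b, u = comb a b).

Lemma coordP u : N u -> exists b, u = comb (coord u) b.
Proof.
move=> /N_comb [a [b e]].
by apply: (epsilon_spec _ (fun a => exists b, u = comb a b)); exists a, b.
Qed.

Definition socle_proj (u : M) : M := lcomb p (coord u).

Lemma socle_proj_comb a b : N (socle_proj (comb a b) - lcomb p a).
Proof.
have [b' e] := coordP (comb_N a b).
by rewrite /socle_proj -lcombB; apply: lcomb_quot_kbasis_N; exact: comb_coef_m (esym e).
Qed.

Lemma socle_proj_colon_m u : colon_m N (socle_proj u).
Proof. by apply: submod_lcomb (submodule_colon_m hN) _ => i; apply: hp.1. Qed.

Lemma socle_proj_linear r u v : N u -> N v ->
  N (socle_proj (r *: u + v) - (r *: socle_proj u + socle_proj v)).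
Proof.
move=> /coordP [bu eu] /coordP [bv ev].
pose a i := r * coord u i + coord v i; pose b j := r * bu j + bv j.
have -> : r *: u + v = comb a b.
  by rewrite {1}eu {1}ev !lcombD !lcombZ scalerDr addrACA.
by have := socle_proj_comb a b; rewrite (lcombD p) (lcombZ p).
Qed.

Lemma socle_proj_smul u : smul x N u -> N (socle_proj u).
Proof.
move=> [n [/coordP [b e] ->]].
have -> : x *: n = comb (fun i => x * coord n i) (fun j => x * b j).
  by rewrite {1}e scalerDr !lcombZ.
rewrite -[socle_proj _](subrK (lcomb p (fun i => x * coord n i))).
by apply: (submodD hN (socle_proj_comb _ _)); apply: lcomb_quot_kbasis_N => i; apply: in_mMr.
Qed.

Lemma socle_proj_x s : colon_m N s -> N (socle_proj (x *: s) - s).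
Proof.
move=> /hp.2.1 [a]; set n := s - _ => Nn; have [b e] := coordP Nn.
have sE : s = n + lcomb p a by rewrite subrK.
pose a' i := x * coord n i + a i; pose b' j := x * b j.
have -> : x *: s = comb a' b'.
  by rewrite {1}sE scalerDr {1}e scalerDr lcombD !lcombZ !lcombZf addrAC.
rewrite -(subrK (lcomb p a') (socle_proj _)) -addrA.
apply: (submodD hN (socle_proj_comb _ _)).
have -> : lcomb p a' - s = x *: socle_proj n - n.
  by rewrite lcombD lcombZ {1}sE opprD addrACA subrr addr0.
by apply: (submodB hN _ Nn); apply: socle_proj_colon_m.
Qed.

Definition m_coord (i0 : 'I_l) (u : M) : Prop := exists a b, u = comb a b /\ in_m (a i0).

Lemma submodule_m_coord i0 : local_ring R -> submodule (m_coord i0).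
Proof.
move=> hloc; split.
  by exists (fun=> 0), (fun=> 0); rewrite !lcomb0 addr0; split=> //; apply: in_m0.
split.
  move=> _ _ [a [b [-> ma]]] [a' [b' [-> ma']]].
  exists (fun i => a i + a' i), (fun j => b j + b' j).
  by split; [rewrite !lcombD addrACA | apply: hloc].
move=> r _ [a [b [-> ma]]]; exists (fun i => r * a i), (fun j => r * b j).
by split; [rewrite scalerDr !lcombZ | apply: in_mMl].
Qed.

Lemma smul_m_coord i0 v : smul x N v -> m_coord i0 v.
Proof.
move=> [n [/coordP [b en] ->]]; exists (fun i => x * coord n i), (fun j => x * b j).
by split; [rewrite {1}en scalerDr !lcombZ | apply: in_mMr].
Qed.

Lemma m_coord_scale_xp i0 r : local_ring R -> m_coord i0 (r *: (x *: p i0)) -> in_m r.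
Proof.
move=> hloc [a [b [er ma]]]; apply: (in_m_subr hloc _ ma).
move: er; rewrite -(lcomb_delta (fun i => x *: p i)) -[LHS]addr0 -(lcomb0 z).
by move/comb_coef_m/(_ i0); rewrite eqxx.
Qed.

Lemma residue_field_summand (i0 : 'I_l) : local_ring R ->
  exists (e : M) (C : M -> Prop),
    N e /\ (forall r, smul x N (r *: e) <-> in_m r) /\
    submodule C /\ (forall v, smul x N v -> C v) /\ (forall v, C v -> N v) /\
    (forall u, N u -> exists r c, C c /\ u = r *: e + c) /\
    (forall r, C (r *: e) -> smul x N (r *: e)).
Proof.
move=> hloc; pose e := x *: p i0.
have xN_e r : in_m r -> smul x N (r *: e).
  by move=> mr; exists (r *: p i0); split; [exact: hp.1 | rewrite !scalerA mulrC].
exists e, (m_coord i0); split; first exact: quot_kbasis_xN.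
split.
  by move=> r; split=> [/(smul_m_coord i0) /(m_coord_scale_xp hloc) | /xN_e].
split; first exact: submodule_m_coord.
split; first exact: smul_m_coord.
split; first by move=> _ [a [b [-> _]]]; apply: comb_N.
split; last by move=> r /(m_coord_scale_xp hloc) /xN_e.
move=> u /N_comb [a [b ->]].
pose a' i := a i - (if i == i0 then a i0 else 0).
exists (a i0), (comb a' b); split.
  by exists a', b; split=> //; rewrite /a' eqxx subrr; apply: in_m0.
by rewrite lcombB lcomb_delta -/e addrA [a i0 *: e + _]addrC subrK.
Qed.

End Coordinates.
End Basis.
End MFull.

Theorem proposition2p3 (R : comUnitRingType) (M : lmodType R)
  (N : M -> Prop) (x : R) :
  local_ring R -> noetherian R -> fin_gen M ->
  submodule N -> m_full N -> in_m x -> same_set (colon (mmul N) x) N ->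
  (* (1) *)
  same_set (colon N x) (colon_m N) /\
  (forall (l : nat) (p : 'I_l -> M), quot_kbasis N p ->
    (* (2) *)
    (exists (m : nat) (z : 'I_m -> M),
       minimal_gen N ([seq x *: p i | i <- enum 'I_l] ++ [seq z j | j <- enum 'I_m])) /\
    (* (3) *)
    (forall (m : nat) (z : 'I_m -> M),
       minimal_gen N ([seq x *: p i | i <- enum 'I_l] ++ [seq z j | j <- enum 'I_m]) ->
       exists phi : M -> M,
         (forall u, N u -> colon_m N (phi u)) /\
         (forall (a : 'I_l -> R) (b : 'I_m -> R),
            N (phi (\sum_(i < l) a i *: (x *: p i) + \sum_(j < m) b j *: z j)
               - \sum_(i < l) a i *: p i)) /\
         (forall r u v, N u -> N v ->
            N (phi (r *: u + v) - (r *: phi u + phi v))))) /\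
  (* (4) psi : (N :_M m)/N -> N/xN, s + N |-> xs + xN, is a split injection *)
  ((forall s, colon_m N s -> N (x *: s)) /\
   (forall s, N s -> smul x N (x *: s)) /\
   (forall s, colon_m N s -> smul x N (x *: s) -> N s) /\
   (exists rho : M -> M,
      (forall u, N u -> colon_m N (rho u)) /\
      (forall u, smul x N u -> N (rho u)) /\
      (forall r u v, N u -> N v -> N (rho (r *: u + v) - (r *: rho u + rho v))) /\
      (forall s, colon_m N s -> N (rho (x *: s) - s)))) /\
  (* (5) k is a direct summand of N/xN  (when (N :_M m) <> N, see NOTES) *)
  ((exists s, colon_m N s /\ ~ N s) ->
   exists (e : M) (C : M -> Prop),
     N e /\ (forall r, smul x N (r *: e) <-> in_m r) /\
     submodule C /\ (forall v, smul x N v -> C v) /\ (forall v, C v -> N v) /\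
     (forall u, N u -> exists r c, C c /\ u = r *: e + c) /\
     (forall r, C (r *: e) -> smul x N (r *: e))).
Proof.
move=> hloc hR hM hN _ hx hfull.
have gN := fin_gen_submodule_generates hR hM hN.
have gC := fin_gen_submodule_generates hR hM (submodule_colon_m hN).
have [l [p hp]] := exists_quot_kbasis hN gN gC.
have [m [z hmin]] := exists_minimal_gen_ext hx hfull hp gN.
split; first exact: colon_x_colon_m.
split.
  move=> l' p' hp'; split; first exact: exists_minimal_gen_ext.
  move=> m' z' hmin'; exists (socle_proj x p' z').
  split; first by move=> u _; apply: (socle_proj_colon_m x hN hp' z' u).
  split; first by move=> a b; exact: (socle_proj_comb hN hp' hmin' a b).
  by move=> r u v; apply: (socle_proj_linear hN hp' hmin' r).
split.
  split; first by move=> s Cs; apply: Cs.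
  split; first by move=> s Ns; exists s.
  split; first by move=> s _; apply: smul_x_inj.
  exists (socle_proj x p z).
  split; first by move=> u _; apply: (socle_proj_colon_m x hN hp z u).
  split; first by move=> u; apply: (socle_proj_smul hN hx hp hmin).
  split; first by move=> r u v; apply: (socle_proj_linear hN hp hmin r).
  by move=> s; apply: (socle_proj_x hN hx hp hmin).
move=> [s [Cs nNs]]; have [l0 | l_gt0] := posnP l.
  by subst l; have [a] := hp.2.1 s Cs; rewrite big_ord0 subr0.
exact: (residue_field_summand hN hx hp hmin (Ordinal l_gt0)).
Qed.
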